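(* Let $p$ be a prime, let $r\ge 1$ and $\alpha_1,\dots,\alpha_r\ge 1$ be integers, let $G=\mathbb{Z}_{p^{\alpha_1}}\oplus\cdots\oplus\mathbb{Z}_{p^{\alpha_r}}$ be a $p$-group of rank $r$, and let $h=\sum_{i=1}^r\alpha_i$. (1) Let $m\ge 1$ be an integer and suppose that $p^h>\sum_{j=1}^r m(p^{\alpha_j}-1)$. Then $$\mathsf{EGZ}(p^h,G,m)\le p^h+m\sum_{j=1}^r(p^{\alpha_j}-1).$$ (2) Let $s\ge 0$ and $t\ge p^s$ be integers. Then $$\mathsf{EGZ}(t,G,p^s)\ge t+p^s\sum_{j=1}^r(p^{\alpha_j}-1).$$ (3) Let $s\ge 0$ be an integer and suppose that $p^h>\sum_{j=1}^r p^s(p^{\alpha_j}-1)$. Then $$\mathsf{EGZ}(p^h,G,p^s)=p^h+p^s\sum_{j=1}^r(p^{\alpha_j}-1).$$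
   Context: $G=\mathbb{Z}_{p^{\alpha_1}}\oplus\cdots\oplus\mathbb{Z}_{p^{\alpha_r}}$ is regarded as a finite commutative ring with coordinate-wise operations. A sequence $S$ over $G$ is a finite sequence of elements of $G$, order disregarded and repetition allowed (i.e. a finite multiset); its length $|S|$ is the number of its elements counted with multiplicity; a subsequence is a sub-multiset. For a positive integer $m$ and a sequence $S=(g_1,\dots,g_\ell)$ over $G$, $$e_m(S)=\sum_{1\le i_1<\cdots<i_m\le \ell}\ \prod_{j=1}^m g_{i_j}\in G$$ (an empty sum is $0$). $\mathsf{EGZ}(t,G,m)$ denotes the smallest positive integer $z$ such that every sequence $S$ over $G$ of length $|S|\ge z$ contains a subsequence $S'$ of length exactly $t$ with $e_m(S')=0$; if no such $z$ exists, $\mathsf{EGZ}(t,G,m)=\infty$. *)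

(* Defs.v *)
From HB Require Import structures.
From mathcomp Require Import all_boot all_order all_algebra.
From mathcomp Require Import finmap multiset.
From mathcomp Require Import boolp constructive_ereal.

Set Implicit Arguments.
Unset Strict Implicit.
Unset Printing Implicit Defensive.

Import Order.TTheory GRing.Theory Num.Theory.

Local Open Scope ring_scope.
Local Open Scope mset_scope.

(* [{ffun _}] carries a ring structure only in the non-dependent case, so the
   product of a family of rings is set up here, on an alias of [{dffun _}]. *)
Section ProdRing.

Definition prod_ring (I : finType) (A : I -> comPzRingType) : Type :=
  {dffun forall i : I, A i}.

Variables (I : finType) (A : I -> comPzRingType).

HB.instance Definition _ := Choice.copy (prod_ring A) {dffun forall i : I, A i}.

Implicit Types f g : prod_ring A.

Definition prod_zero : prod_ring A := [ffun i => 0 : A i].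
Definition prod_opp f : prod_ring A := [ffun i => - f i : A i].
Definition prod_add f g : prod_ring A := [ffun i => f i + g i : A i].
Definition prod_one : prod_ring A := [ffun i => 1 : A i].
Definition prod_mul f g : prod_ring A := [ffun i => f i * g i : A i].

Fact prod_addA : associative prod_add.
Proof. by move=> f g h; apply/ffunP=> i; rewrite !ffunE addrA. Qed.
Fact prod_addC : commutative prod_add.
Proof. by move=> f g; apply/ffunP=> i; rewrite !ffunE addrC. Qed.
Fact prod_add0 : left_id prod_zero prod_add.
Proof. by move=> f; apply/ffunP=> i; rewrite !ffunE add0r. Qed.
Fact prod_addN : left_inverse prod_zero prod_opp prod_add.
Proof. by move=> f; apply/ffunP=> i; rewrite !ffunE addNr. Qed.

HB.instance Definition _ :=
  GRing.isZmodule.Build (prod_ring A) prod_addA prod_addC prod_add0 prod_addN.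

Fact prod_mulA : associative prod_mul.
Proof. by move=> f g h; apply/ffunP=> i; rewrite !ffunE mulrA. Qed.
Fact prod_mulC : commutative prod_mul.
Proof. by move=> f g; apply/ffunP=> i; rewrite !ffunE mulrC. Qed.
Fact prod_mul1 : left_id prod_one prod_mul.
Proof. by move=> f; apply/ffunP=> i; rewrite !ffunE mul1r. Qed.
Fact prod_mulDl : left_distributive prod_mul prod_add.
Proof. by move=> f g h; apply/ffunP=> i; rewrite !ffunE mulrDl. Qed.

HB.instance Definition _ :=
  GRing.Zmodule_isComPzRing.Build (prod_ring A)
    prod_mulA prod_mulC prod_mul1 prod_mulDl.

End ProdRing.

(* ['Z_n] is the ring of integers mod n only for n > 1, so this is the intended
   ring when p is prime and every [alpha i] is positive. *)
Definition pgroup_ring (p r : nat) (alpha : 'I_r -> nat) : comPzRingType :=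
  prod_ring (fun i : 'I_r => 'Z_(p ^ alpha i)).

(* The multiset S is enumerated as S`_0, ..., S`_(size S).-1; increasing
   m-tuples of positions are encoded as m-element sets of positions. *)
Definition elem_sym (G : comPzRingType) (m : nat) (S : {mset G}) : G :=
  \sum_(J : {set 'I_(size S)} | #|J| == m) \prod_(i in J) S`_i.

Definition EGZ_bound (t : nat) (G : comPzRingType) (m z : nat) : Prop :=
  (0 < z)%N /\
  forall S : {mset G}, (z <= size S)%N ->
    exists S' : {mset G}, [/\ S' `<=` S, size S' = t & elem_sym m S' = 0].

Definition EGZ (t : nat) (G : comPzRingType) (m : nat) : \bar int :=
  match pselect (exists z : nat, `[< EGZ_bound t G m z >]) with
  | left ex => ((ex_minn ex)%:Z)%:E
  | right _ => +oo%E
  end.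

(* Main.v *)
Require Import Defs.
From mathcomp Require Import all_boot all_order all_algebra.
From mathcomp Require Import constructive_ereal.
From mathcomp Require Import finmap multiset boolp.
From mathcomp Require Import zify.

(** Upper bound: for f : T -> G, the number of K of size m inside J, weighted by
    integer lifts of the products, is a degree m polynomial on the cube {0,1}^T
    giving e_m of the subsequence indexed by J, and "p ^ a divides n" is
    detected mod p by the binomial 'C(n + p ^ a - 1, p ^ a - 1).  If no nonempty
    J had p ^ h | #|J| and e_m = 0, the product of these detectors would be the
    indicator of set0 mod p, whose degree is #|T|, more than the degree allows.

    Lower bound: let g_c be the element equal to 1 at the coordinates i >= c and
    0 elsewhere.  Take p ^ s - 1 + p ^ s (p ^ alpha_0 - 1) copies of g_0,
    p ^ s (p ^ alpha_j - 1) copies of g_j for j > 0, and t - p ^ s zeros.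
    At each coordinate e_{p ^ s} is a binomial 'C(n, p ^ s), which p ^ alpha_j
    does not divide for p ^ s <= n < p ^ (s + alpha_j); hence a subsequence with
    e_{p ^ s} = 0 has fewer than p ^ s nonzero elements. *)

Set Implicit Arguments.
Unset Strict Implicit.
Unset Printing Implicit Defensive.

Import Order.TTheory GRing.Theory Num.Theory.

(** * p-adic valuations of binomial coefficients *)

(** With q = p ^ a, compare valuations in (n + q) C(n + q - 1, q - 1) = q C(n + q, q): the right
    side has at least a, while n + q has less than a. *)
Lemma dvdn_bin_predX (p a n : nat) : prime p -> ~~ (p ^ a %| n) ->
  p %| 'C(n + (p ^ a).-1, (p ^ a).-1).
Proof.
move=> p_pr; have q_gt0 : 0 < p ^ a by rewrite expn_gt0 prime_gt0.
have : ~~ (p ^ a %| n + p ^ a) = ~~ (p ^ a %| n) by rewrite dvdn_addl.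
move=> <-; rewrite pfactor_dvdn ?addn_gt0 ?q_gt0 ?orbT // -ltnNge => v_lt.
have /(congr1 (logn p)) := mul_bin_diag (n + p ^ a) (p ^ a).-1.
rewrite -subn1 -addnBA // subn1 prednK // !lognM ?bin_gt0 ?leq_addl ?addn_gt0
  ?q_gt0 ?orbT // pfactorK // => e.
suff : 0 < logn p 'C(n + (p ^ a).-1, (p ^ a).-1).
  by rewrite logn_gt0 mem_primes => /and3P[].
lia.
Qed.

Lemma sum_divn_expn (p n N M : nat) : n < p ^ N -> 0 < N -> N <= M ->
  \sum_(1 <= k < M) n %/ p ^ k = \sum_(1 <= k < N) n %/ p ^ k.
Proof.
move=> n_lt N_gt0 leNM; rewrite (@big_cat_nat _ _ _ N) //=.
rewrite [X in _ + X]big_nat_cond [X in _ + X]big1 ?addn0 // => k.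
case/andP=> /andP[leNk _] _; rewrite divn_small // (leq_trans n_lt) //.
by rewrite leq_pexp2l //; case: p n_lt => //; rewrite exp0n.
Qed.

(** Legendre's formula with a cutoff depending only on N, so that the three factorials of a binomial
    give sums over one range, comparable term by term. *)
Lemma logn_fact_lt_expn (p n N : nat) : prime p -> n < p ^ N -> 0 < N ->
  logn p n`! = \sum_(1 <= k < N) n %/ p ^ k.
Proof.
move=> p_pr n_lt N_gt0; rewrite logn_fact //.
have ltn_p k : k < p ^ k by rewrite ltn_expl ?prime_gt1.
rewrite -(@sum_divn_expn p n n.+1 (N + n.+1)) ?leq_addl //; last exact: ltnW.
by rewrite (sum_divn_expn n_lt) ?leq_addr.
Qed.

(* Kummer: of the [s + a] possible digit positions, subtracting [p ^ s] from
   [n] can only borrow at the [a - 1] positions strictly between. *)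
Lemma logn_bin_expn (p s a n : nat) : prime p -> p ^ s <= n < p ^ (s + a) ->
  logn p 'C(n, p ^ s) < a.
Proof.
move=> p_pr /andP[le_n lt_n].
have p_gt0 := prime_gt0 p_pr; have p_gt1 := prime_gt1 p_pr.
have a_gt0 : 0 < a.
  by case: a lt_n => // ; rewrite addn0 ltnNge le_n.
have sa_gt0 : 0 < s + a by rewrite addn_gt0 a_gt0 orbT.
have /(congr1 (logn p)) := bin_fact le_n.
rewrite !lognM ?muln_gt0 ?fact_gt0 ?bin_gt0 //.
rewrite !(@logn_fact_lt_expn p _ (s + a)) //; first last.
- by rewrite ltn_exp2l // -[X in X < _]addn0 ltn_add2l.
- by apply: leq_ltn_trans lt_n; rewrite leq_subr.
rewrite -big_split /=.
suff : \sum_(1 <= k < s + a) n %/ p ^ k <=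
   \sum_(1 <= k < s + a) (p ^ s %/ p ^ k + (n - p ^ s) %/ p ^ k) + a.-1 by lia.
rewrite (@big_cat_nat _ _ _ s.+1 1 (s + a)) //=; last by lia.
rewrite (@big_cat_nat _ _ _ s.+1 1 (s + a)) //=; last by lia.
rewrite -addnA leq_add //.
  (* For k <= s, p ^ k divides p ^ s, so the floors add up exactly. *)
  rewrite big_nat_cond [X in _ <= X]big_nat_cond leq_sum // => k.
  rewrite andbT => /andP[k_gt0 k_le]; rewrite -divnDl ?dvdn_exp2l //.
  by rewrite subnKC.
(* The indices s < k < s + a number a - 1, and each costs at most 1 because n <= n - p ^ s + p ^
   k. *)
have -> : a.-1 = \sum_(s.+1 <= k < s + a) 1 by rewrite sum_nat_const_nat; lia.
rewrite -big_split big_nat_cond [X in _ <= X]big_nat_cond leq_sum // => k.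
rewrite andbT => /andP[k_gt k_lt] /=.
rewrite [p ^ s %/ _]divn_small ?ltn_exp2l // add0n.
apply: (@leq_trans ((n - p ^ s + p ^ k) %/ p ^ k)).
  have : p ^ s <= p ^ k by rewrite leq_exp2l // ltnW.
  by move=> le_sk; rewrite leq_div2r // addnBAC // -addnBA // leq_addr.
by rewrite divnDr // divnn expn_gt0 p_gt0.
Qed.

Lemma leq_count_msubset (K : choiceType) (P : pred K) (A B : {mset K}%mset) :
  (A `<=` B)%mset -> count P A <= count P B.
Proof.
move=> /msubsetP sAB; have /count_subseqP[s s_sub perm_s] :
  forall x, count_mem x A <= count_mem x B by move=> x; rewrite !count_mem_mset.
by rewrite (permP perm_s) leq_count_subseq.
Qed.

(** * Polynomials on the cube of subsets *)

Section SetPolynomials.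

Variable T : finType.
Implicit Types (F H : {set T} -> nat) (J K : {set T}) (L : seq {set T}).

(* A polynomial with natural coefficients on the cube {0,1}^T: the list L of
   its monomials is evaluated at the indicator of J. *)
Definition has_degree d F := exists L,
  all (fun K => #|K| <= d) L /\ F =1 (fun J => count (fun K => K \subset J) L).

Lemma has_degreeW d e F : d <= e -> has_degree d F -> has_degree e F.
Proof.
move=> le_de [L [dL eF]]; exists L; split=> //.
by apply: sub_all dL => K /leq_trans->.
Qed.

Lemma eq_has_degree d F H : F =1 H -> has_degree d F -> has_degree d H.
Proof. by move=> eFH [L [dL eF]]; exists L; split=> // J; rewrite -eFH. Qed.

Lemma has_degree1 : has_degree 0 (fun=> 1).
Proof.
by exists [:: set0]; split=> [|J]; rewrite /= ?cards0 ?sub0set.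
Qed.

Lemma has_degree0 : has_degree 0 (fun=> 0).
Proof. by exists [::]. Qed.

Lemma has_degree_subset K : has_degree #|K| (fun J => K \subset J).
Proof. by exists [:: K]; split=> [|J]; rewrite /= ?leqnn ?addn0. Qed.

Lemma has_degreeD d F H :
  has_degree d F -> has_degree d H -> has_degree d (fun J => F J + H J).
Proof.
move=> [L [dL eF]] [M [dM eH]]; exists (L ++ M).
by rewrite all_cat dL dM; split=> // J; rewrite count_cat eF eH.
Qed.

(** Variables are idempotent on the cube, so two monomials multiply to the monomial of their
    union. *)
Lemma has_degreeM d e F H :
  has_degree d F -> has_degree e H -> has_degree (d + e) (fun J => F J * H J).
Proof.
move=> [L [dL eF]] [M [dM eH]].
exists [seq K :|: K' | K <- L, K' <- M]; split.
  apply/allP=> _ /allpairsP[[K K'] /= [/(allP dL) ? /(allP dM) ? ->]].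
  by rewrite (leq_trans (leq_card_setU _ _)) ?leq_add.
move=> J; rewrite eF eH; elim: L {dL eF} => //= K L IH.
rewrite count_cat -IH mulnDl; congr (_ + _); rewrite count_map.
have [sKJ|nsKJ] := boolP (K \subset J).
  by rewrite mul1n; apply: eq_count => K' /=; rewrite subUset sKJ.
rewrite mul0n -(count_pred0 M); apply: eq_count => K' /=.
by rewrite subUset (negPf nsKJ).
Qed.

Lemma has_degree_prod (I : Type) (r : seq I) (d : I -> nat)
    (F : I -> {set T} -> nat) : (forall i, has_degree (d i) (F i)) ->
  has_degree (\sum_(i <- r) d i) (fun J => \prod_(i <- r) F i J).
Proof.
move=> dF; elim: r => [|i r IHr].
  rewrite big_nil; apply: eq_has_degree has_degree1 => J.
  by rewrite big_nil.
rewrite big_cons; apply: eq_has_degree (has_degreeM (dF i) IHr) => J.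
by rewrite big_cons.
Qed.

(** Induction on the list of monomials by Pascal's rule. No division by k! occurs, so the result
    survives reduction mod p. *)
Lemma has_degree_bin d k F :
  has_degree d F -> has_degree (d * k) (fun J => 'C(F J, k)).
Proof.
move=> [L [dL eF]].
apply: (@eq_has_degree _ (fun J => 'C(count (fun K => K \subset J) L, k))).
  by move=> J; rewrite eF.
elim: L k {eF} dL => [|K L IH] k /=.
  case: k => [|k] _; last exact: has_degreeW (has_degree0).
  by rewrite muln0; apply: has_degree1.
case/andP=> dK dL; case: k => [|k].
  by apply: eq_has_degree (IH 0 dL) => J; rewrite !bin0.
have dH : has_degree (d * k.+1) (fun J => (K \subset J) *
    'C(count (fun K => K \subset J) L, k)).
  rewrite mulnS; apply: has_degreeM; last exact: IH.
  exact: has_degreeW dK (has_degree_subset K).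
apply: eq_has_degree (has_degreeD (IH k.+1 dL) dH) => J.
by case: (K \subset J); rewrite ?mul0n ?addn0 // mul1n add1n binS.
Qed.

Lemma has_degree_const c : has_degree 0 (fun=> c).
Proof.
elim: c => [|c IH]; first exact: has_degree0.
exact: has_degreeD has_degree1 IH.
Qed.

Lemma has_degree_sum (I : Type) (r : seq I) (P : pred I) d
    (F : I -> {set T} -> nat) : (forall i, P i -> has_degree d (F i)) ->
  has_degree d (fun J => \sum_(i <- r | P i) F i J).
Proof.
move=> dF; elim: r => [|i r IHr].
  apply: eq_has_degree (has_degreeW (leq0n d) has_degree0) => J.
  by rewrite big_nil.
have [Pi|nPi] := boolP (P i).
  apply: eq_has_degree (has_degreeD (dF i Pi) IHr) => J.
  by rewrite big_cons Pi.
by apply: eq_has_degree IHr => J; rewrite big_cons (negPf nPi).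
Qed.

(** Toggling a point outside K pairs subsets of equal weight and opposite sign. *)
Lemma alternating_sum_subset (R : pzRingType) K : #|K| < #|T| ->
  (\sum_(J : {set T}) (-1) ^+ #|J| * (K \subset J)%:R = 0 :> R)%R.
Proof.
move=> ltK; have [x xK] : exists x, x \notin K.
  apply/existsP; rewrite -negb_forall; apply: contraL ltK => /forallP KT.
  by rewrite -leqNgt subset_leq_card //; apply/subsetP=> x _; apply: KT.
rewrite (bigID (fun J : {set T} => x \in J)) /=.
rewrite (reindex_onto (fun J => x |: J) (fun J => J :\ x)) /=; last first.
  by move=> J xJ; rewrite setD1K.
rewrite -[RHS](addNr (\sum_(J : {set T} | x \notin J)
  (-1) ^+ #|J| * (K \subset J)%:R)%R); congr (_ + _)%R.
rewrite -sumrN; apply: eq_big => [J | J].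
  rewrite setU11 /=; apply/eqP/idP => [<-|/setU1K //].
  by rewrite !inE eqxx.
case/andP=> _ /eqP eJ; have xJ : x \notin J by rewrite -eJ !inE eqxx.
rewrite cardsU1 xJ exprS mulN1r mulNr; congr (- (_ * _%:R))%R; congr nat_of_bool.
by rewrite -subDset (_ : K :\: [set x] = K) //; apply/setDidPl; rewrite disjoint_sym disjoints1.
Qed.

Lemma alternating_sum_has_degree (R : pzRingType) d F :
  has_degree d F -> d < #|T| ->
  (\sum_(J : {set T}) (-1) ^+ #|J| * (F J)%:R = 0 :> R)%R.
Proof.
move=> [L [dL eF]] ltd.
rewrite (eq_bigr _ (fun J _ => congr1 (fun n => (-1) ^+ #|J| * n%:R)%R (eF J))).
elim: L dL {eF} => [|K L IH] /=; first by rewrite big1 // => J _; rewrite mulr0.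
case/andP=> dK dL; rewrite (eq_bigr _ (fun J _ => congr1 _ (natrD _ _ _))).
rewrite (eq_bigr _ (fun J _ => mulrDr _ _ _)) big_split /= IH // addr0.
by apply: alternating_sum_subset; apply: leq_ltn_trans ltd.
Qed.

(** If p divided every [F J] with J nonempty, the alternating sum over ['F_p] would reduce to
    [F set0], that is 1, whereas the degree bound makes it 0. *)
Lemma has_degree_nonvanish (p d : nat) F : prime p -> has_degree d F ->
  d < #|T| -> F set0 = 1 -> exists2 J, J != set0 & ~~ (p %| F J).
Proof.
move=> p_pr dF ltd F0; apply/exists_inP; apply: contraT.
rewrite negb_exists_in => /forall_inP Fp.
have := alternating_sum_has_degree 'F_p dF ltd.
rewrite (bigD1 set0) //= big1 => [|J /Fp].
  by rewrite F0 cards0 addr0 mulr1 => /eqP; rewrite oner_eq0.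
rewrite negbK => pF; apply/eqP; rewrite mulf_eq0; apply/orP; right.
by rewrite -(dvdn_pcharf (pchar_Fp p_pr)).
Qed.

End SetPolynomials.

(** * Elementary symmetric sums of indexed families *)

(** A multiset built from a sequence may be enumerated in another order; this pulls the reordering
    back to the indices. *)
Lemma perm_eq_mapP (A B : eqType) (f : A -> B) (s : seq B) (t : seq A) :
  perm_eq s (map f t) -> exists2 e, perm_eq e t & s = map f e.
Proof.
elim: s t => [|x s IHs] t st.
  by exists t => //; case: t st => // a t /perm_size.
have : x \in map f t by rewrite -(perm_mem st) mem_head.
case/mapP=> a at_ ex; have ta := perm_to_rem at_.
have : perm_eq (x :: s) (x :: map f (rem a t)).
  by rewrite (permPl st) ex -map_cons perm_map.
rewrite perm_cons => /IHs[e pe ->]; exists (a :: e); last by rewrite ex.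
by rewrite perm_sym (permPl ta) perm_cons perm_sym.
Qed.

Section ElemSym.

Local Open Scope ring_scope.

(** As [e] has no repetition, sending a position to its index is injective and matches m-sets of
    positions with m-subsets of the entries of [e]. *)
Lemma sum_prod_nth_map (R : comPzRingType) (I : finType) (f : I -> R)
    (e : seq I) (m : nat) : uniq e ->
  \sum_(J : {set 'I_(size (map f e))} | #|J| == m) \prod_(i in J) (map f e)`_i
  = \sum_(K : {set I} | (#|K| == m) && (K \subset e)) \prod_(i in K) f i.
Proof.
move=> ue.
pose g (i : 'I_(size (map f e))) := tnth (in_tuple e) (cast_ord (size_map f e) i).
have g_inj : injective g.
  have /tuple_uniqP tnth_inj : uniq (in_tuple e) by [].
  by move=> i j /tnth_inj/cast_ord_inj.
have gE i : f (g i) = (map f e)`_i.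
  have ltie : (i < size e)%N by rewrite -(size_map f).
  by rewrite /g (tnth_nth (g i)) /= (nth_map (g i)).
rewrite [RHS](reindex_onto (fun J : {set 'I_(size (map f e))} => g @: J)
  (fun K : {set I} => g @^-1: K)) /=.
  apply: eq_big => [J | J _].
    rewrite card_imset // -andbA; case: (_ == _) => //=; symmetry.
    apply/andP; split.
      by apply/subsetP=> _ /imsetP[i _ ->]; rewrite mem_tnth.
    by apply/eqP/setP=> i; rewrite inE mem_imset.
  rewrite big_imset /=; last by move=> i j _ _ /g_inj.
  by apply: eq_bigr => i _.
move=> K /andP[_ sKe]; apply/setP=> x; apply/imsetP/idP => [[i]|xK].
  by rewrite inE => ? ->.
have /tnthP[i xi] : x \in in_tuple e by apply: (subsetP sKe).
exists (cast_ord (esym (size_map f e)) i); last by rewrite /g cast_ordKV.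
by rewrite inE /g cast_ordKV -xi.
Qed.

Lemma elem_sym_seq_mset (R : comPzRingType) (I : finType) (f : I -> R)
    (J : {set I}) (m : nat) :
  elem_sym m (seq_mset [seq f i | i <- enum J])
  = \sum_(K : {set I} | (#|K| == m) && (K \subset J)) \prod_(i in K) f i.
Proof.
have [e pe se] := perm_eq_mapP (perm_eq_seq_mset [seq f i | i <- enum J]).
rewrite /elem_sym se sum_prod_nth_map; last by rewrite (perm_uniq pe) enum_uniq.
apply: eq_bigl => K; congr (_ && _); apply/subsetP/subsetP => sK x /sK;
  by rewrite (perm_mem pe) mem_enum.
Qed.

Section ProdRingProj.

Variables (I : finType) (A : I -> comPzRingType).

Lemma prod_ring_sumE (T : Type) (s : seq T) (P : pred T) (F : T -> prod_ring A) i :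
  (\sum_(x <- s | P x) F x) i = \sum_(x <- s | P x) (F x i).
Proof.
by apply: (big_morph (fun f : prod_ring A => f i)) => [f g|]; rewrite ffunE.
Qed.

Lemma prod_ring_prodE (T : Type) (s : seq T) (P : pred T) (F : T -> prod_ring A) i :
  (\prod_(x <- s | P x) F x) i = \prod_(x <- s | P x) (F x i).
Proof.
by apply: (big_morph (fun f : prod_ring A => f i)) => [f g|]; rewrite ffunE.
Qed.

(** A product of 0/1 values is nonzero only if all its positions satisfy P, and is then 1; what
    remains counts the m-sets of such positions. *)
Lemma elem_sym_indicator (S : {mset prod_ring A}%mset) (m : nat) (i : I)
    (P : pred (prod_ring A)) :
  (forall x : prod_ring A, x \in (S : seq _) -> x i = (P x)%:R) ->
  elem_sym m S i = 'C(count P S, m)%:R.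
Proof.
move=> SP; pose B := [set k : 'I_(size S) | P S`_k].
have -> : count P S = #|B|.
  rewrite -sum1_count (big_nth 0) big_mkord -sum1_card.
  by apply: eq_bigl => k; rewrite inE.
rewrite /elem_sym prod_ring_sumE -cards_draws -sum1_card natr_sum.
rewrite [LHS](bigID (fun J : {set _} => J \subset B)) /= [X in _ + X]big1 ?addr0.
  apply: eq_big => [J | J /andP[_ sJB]]; first by rewrite inE andbC.
  rewrite prod_ring_prodE big1 // => k /(subsetP sJB); rewrite inE => Pk.
  by rewrite SP ?mem_nth // Pk.
move=> J /andP[_ /subsetPn[k kJ kB]]; rewrite prod_ring_prodE (bigD1 k) //=.
by rewrite SP ?mem_nth //; move: kB; rewrite inE => /negPf->; rewrite mul0r.
Qed.

End ProdRingProj.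

End ElemSym.

(** * Vanishing mod q, and bounds on [EGZ] from [EGZ_bound] *)

Lemma Zp_nat_eq0 (q n : nat) : 1 < q -> ((n%:R : 'Z_q)%R == 0%R) = (q %| n).
Proof. by move=> q_gt1; rewrite -val_eqE /= val_Zp_nat. Qed.

Lemma EGZ_le (t : nat) (G : comPzRingType) (m n : nat) :
  EGZ_bound t G m n -> (EGZ t G m <= (Posz n)%:E)%E.
Proof.
rewrite /EGZ => nP; case: pselect => [ex|[]]; last by exists n; apply/asboolP.
by rewrite lee_fin lez_nat; case: ex_minnP => z _; apply; apply/asboolP.
Qed.

Lemma EGZ_ge (t : nat) (G : comPzRingType) (m n : nat) :
  (forall z, EGZ_bound t G m z -> n <= z) -> ((Posz n)%:E <= EGZ t G m)%E.
Proof.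
rewrite /EGZ => nP; case: pselect => [ex|_]; last by rewrite leey.
by rewrite lee_fin lez_nat; case: ex_minnP => z /asboolP/nP.
Qed.

(** * Upper bound *)

Section EGZUpper.

Variables (p r : nat) (alpha : 'I_r -> nat) (m : nat).
Hypotheses (p_prime : prime p) (alpha_gt0 : forall j, 0 < alpha j).

Let G := pgroup_ring p alpha.
Let q_gt1 j : 1 < p ^ alpha j.
Proof. by rewrite -(expn0 p) ltn_exp2l ?prime_gt1. Qed.

Variables (T : finType) (f : T -> G).

(** Letting K range over all m-sets, with containment in J as a factor, keeps the coefficients
    independent of J, as a polynomial on the cube requires. *)
Definition elem_sym_nat (j : 'I_r) (J : {set T}) : nat :=
  \sum_(K : {set T} | #|K| == m)
    (\prod_(i in K) nat_of_ord (f i j)) * (K \subset J).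

Lemma has_degree_elem_sym_nat j : has_degree m (elem_sym_nat j).
Proof.
apply: has_degree_sum => K /eqP <-; rewrite -[X in has_degree X]add0n.
exact: has_degreeM (has_degree_const _ _) (has_degree_subset _).
Qed.

Lemma elem_sym_natE (j : 'I_r) (J : {set T}) :
  elem_sym m (seq_mset [seq f i | i <- enum J]) j = ((elem_sym_nat j J)%:R)%R.
Proof.
rewrite elem_sym_seq_mset prod_ring_sumE natr_sum.
rewrite [RHS](bigID (fun K : {set T} => K \subset J)) /=.
rewrite [X in (_ + X)%R]big1 ?addr0 => [|K /andP[_ /negPf->]]; last by rewrite muln0.
apply: eq_bigr => K /andP[_ ->]; rewrite prod_ring_prodE muln1 natr_prod.
by apply: eq_bigr => i _; rewrite natr_Zp.
Qed.

Lemma elem_sym_seq_mset_eq0 (J : {set T}) :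
  (forall j, p ^ alpha j %| elem_sym_nat j J) ->
  elem_sym m (seq_mset [seq f i | i <- enum J]) = 0%R.
Proof.
move=> qJ; apply/ffunP=> j; rewrite elem_sym_natE ffunE.
by apply/eqP; rewrite Zp_nat_eq0 //; apply: q_gt1.
Qed.

(* 'C(n + p ^ a - 1, p ^ a - 1) is a unit mod p only if p ^ a divides n, so the
   product of these binomials detects the wanted subsets; its degree is too
   small for it to vanish off set0. *)
Lemma exists_elem_sym_nat_dvd (h : nat) : 0 < m ->
  (p ^ h).-1 + \sum_j m * (p ^ alpha j).-1 < #|T| ->
  exists J : {set T}, [/\ J != set0, p ^ h %| #|J| &
    forall j, p ^ alpha j %| elem_sym_nat j J].
Proof.
move=> m_gt0 ltT.
have dcard : has_degree 1 (fun J : {set T} => #|J|).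
  apply: (@eq_has_degree _ _ (fun J : {set T} => \sum_i ([set i] \subset J))).
    move=> J; rewrite -sum1_card [RHS]big_mkcond; apply: eq_bigr => i _.
    by rewrite sub1set; case: ifP.
  by apply: has_degree_sum => i _; rewrite -(cards1 i); apply: has_degree_subset.
have dbin d F a : has_degree d F ->
    has_degree (d * a) (fun J : {set T} => 'C(F J + a, a)).
  move=> dF; apply: has_degree_bin; apply: has_degreeD => //.
  exact: has_degreeW (has_degree_const _ _).
have := has_degreeM (dbin _ _ (p ^ h).-1 dcard)
  (has_degree_prod (index_enum 'I_r)
    (fun j => dbin _ _ (p ^ alpha j).-1 (has_degree_elem_sym_nat j))).
rewrite mul1n => /(has_degree_nonvanish p_prime) /(_ ltT)[].
  (* At [set0] every binomial is C(a, a) = 1; for [elem_sym_nat] this uses m > 0, since no m-set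
     then lies inside [set0]. *)
  rewrite cards0 add0n binn mul1n big1 // => j _.
  rewrite /elem_sym_nat big1 ?add0n ?binn // => K /eqP Km.
  by rewrite subset0 -cards_eq0 Km -[m == 0]negbK -lt0n m_gt0 muln0.
move=> J J0; rewrite Euclid_dvdM // negb_or => /andP[pJ pE].
exists J; split=> // [|j].
  by apply: contraR pJ => /(dvdn_bin_predX p_prime).
apply: contraR pE => /(dvdn_bin_predX p_prime) pE.
by rewrite (bigD1 j) //= dvdn_mulr.
Qed.

End EGZUpper.

Lemma EGZ_pgroup_bound (p r : nat) (alpha : 'I_r -> nat) (h m : nat) :
  prime p -> (forall j, 0 < alpha j) -> 0 < m ->
  \sum_(j < r) m * (p ^ alpha j - 1) < p ^ h ->
  EGZ_bound (p ^ h) (pgroup_ring p alpha) m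
    (p ^ h + m * \sum_(j < r) (p ^ alpha j - 1)).
Proof.
move=> p_pr alpha_gt0 m_gt0 lt_sum; rewrite big_distrr /=.
have ph_gt0 : 0 < p ^ h by rewrite expn_gt0 prime_gt0.
split=> [|S leS]; first by rewrite addn_gt0 ph_gt0.
set l := _ + _ in leS.
(* Only the first l entries of S are used: l exceeds the degree of the detector by one, yet l < 2 p
   ^ h, which forces #|J| = p ^ h. *)
pose f (i : 'I_l) := nth 0%R S i.
have [J [J0 dJ eJ]] : exists J : {set 'I_l}, [/\ J != set0, p ^ h %| #|J| &
    forall j, p ^ alpha j %| elem_sym_nat m f j J].
  apply: exists_elem_sym_nat_dvd => //; rewrite card_ord /l.
  under eq_bigr do rewrite -subn1.
  by rewrite ltn_add2r prednK.
have cardJ : #|J| = p ^ h.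
  have : #|J| < 2 * p ^ h.
    rewrite (leq_ltn_trans (max_card _)) // card_ord /l mul2n -addnn.
    by rewrite ltn_add2l.
  case/dvdnP: dJ => k eJk; rewrite eJk ltn_mul2r ph_gt0 /=.
  move: J0; rewrite -cards_eq0 eJk; case: k {eJk} => [|[|k]] //.
  by rewrite mul1n.
exists (seq_mset [seq f i | i <- enum J]); split; last 1 first.
- exact: elem_sym_seq_mset_eq0.
- apply/msubsetP=> x; rewrite mset_seqE -[S x]count_mem_mset.
  apply: (@leq_trans (count_mem x (take l S))); last first.
    by rewrite -{2}(cat_take_drop l S) count_cat leq_addr.
  rewrite -(_ : [seq f i | i <- enum 'I_l] = take l S); last first.
    apply: (@eq_from_nth _ 0%R) => [|i].
      by rewrite size_map size_enum_ord size_takel.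
    rewrite size_map size_enum_ord => ltil.
    rewrite (nth_map (Ordinal ltil)) ?size_enum_ord // nth_take //.
    by rewrite /f nth_enum_ord.
  by rewrite leq_count_subseq // map_subseq // [enum 'I_l]enumT filter_subseq.
- by rewrite (perm_size (perm_eq_seq_mset _)) size_map -cardE.
Qed.

(** * Lower bound *)

Section EGZLower.

Variables (p r : nat) (alpha : 'I_r -> nat) (s t : nat).
Hypotheses (p_prime : prime p) (r_gt0 : 0 < r).
Hypotheses (alpha_gt0 : forall j, 0 < alpha j) (le_st : p ^ s <= t).

Let q_gt1 j : 1 < p ^ alpha j.
Proof. by rewrite -(expn0 p) ltn_exp2l ?prime_gt1. Qed.

Definition tail_indicator (c : nat) : pgroup_ring p alpha :=
  [ffun i : 'I_r => ((c <= i)%:R : 'Z_(p ^ alpha i))%R].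

(** The index [r] stands for the zero element, as no coordinate i satisfies r <= i. Index 0 occurs
    both in the first block and in the flattened one. *)
Definition extremal_indices : seq nat :=
  nseq (p ^ s).-1 0 ++ flatten [seq nseq (p ^ s * (p ^ alpha j).-1) (val j) | j : 'I_r]
    ++ nseq (t - p ^ s) r.

Definition extremal_mset : {mset pgroup_ring p alpha}%mset :=
  seq_mset (map tail_indicator extremal_indices).

Lemma count_extremal_indices (P : pred nat) : count P extremal_indices =
  P 0 * (p ^ s).-1 + \sum_(j < r) P j * (p ^ s * (p ^ alpha j).-1) + P r * (t - p ^ s).
Proof.
rewrite /extremal_indices !count_cat !count_nseq count_flatten -map_comp.
rewrite sumn_map addnA big_enum; congr (_ + _ + _).
by apply: eq_bigr => j _; rewrite /= count_nseq.
Qed.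

Lemma size_extremal_mset :
  size extremal_mset = (t + p ^ s * \sum_(j < r) (p ^ alpha j - 1)).-1.
Proof.
rewrite (perm_size (perm_eq_seq_mset _)) size_map -count_predT.
rewrite count_extremal_indices !mul1n; under eq_bigr do rewrite mul1n.
rewrite big_distrr /=; under [in RHS]eq_bigr do rewrite subn1.
have : 0 < p ^ s by rewrite expn_gt0 prime_gt0.
by lia.
Qed.

Let one_at (i : 'I_r) := [pred x : pgroup_ring p alpha | x i == 1%R].

Lemma one_at_tail_indicator (i : 'I_r) c : one_at i (tail_indicator c) = (c <= i).
Proof. by rewrite /= ffunE; case: (c <= i); rewrite ?eqxx // eq_sym oner_eq0. Qed.

Lemma extremal_msetE x : x \in (extremal_mset : seq _) ->
  exists c, x = tail_indicator c.
Proof.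
by rewrite (perm_mem (perm_eq_seq_mset _)) => /mapP[c _ ->]; exists c.
Qed.

Lemma count_extremal_mset (P : pred (pgroup_ring p alpha)) :
  count P extremal_mset = count (fun c => P (tail_indicator c)) extremal_indices.
Proof. by rewrite (permP (perm_eq_seq_mset _)) count_map. Qed.

Lemma extremal_mset_zero_free (S : {mset pgroup_ring p alpha}%mset) :
  (S `<=` extremal_mset)%mset -> size S = t -> elem_sym (p ^ s) S <> 0%R.
Proof.
move=> sS szS S0; have ps_gt0 : 0 < p ^ s by rewrite expn_gt0 prime_gt0.
have le_count P : count P S <= P (tail_indicator 0) * (p ^ s).-1 +
    \sum_(j < r) P (tail_indicator j) * (p ^ s * (p ^ alpha j).-1) +
    P (tail_indicator r) * (t - p ^ s).
  rewrite (leq_trans (leq_count_msubset P sS)) // count_extremal_mset.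
  by rewrite count_extremal_indices.
(* Otherwise p ^ alpha i would not divide C(count, p ^ s), which represents coordinate i of e_{p ^
   s}(S) = 0. *)
have count_small (i : 'I_r) :
    count (one_at i) S < p ^ (s + alpha i) -> count (one_at i) S < p ^ s.
  move=> lt_c; rewrite ltnNge; apply/negP => le_c.
  have := logn_bin_expn p_prime (introT andP (conj le_c lt_c)).
  rewrite ltnNge -pfactor_dvdn ?bin_gt0 // => /negP[].
  rewrite -Zp_nat_eq0 // -(@elem_sym_indicator _ _ S _ i) ?S0 ?ffunE // => x xS.
  have /extremal_msetE[c ->] := msubset_subset sS xS.
  by rewrite one_at_tail_indicator ffunE.
have sum_pred1 (P : pred nat) (i : 'I_r) (w : 'I_r -> nat) :
    (forall j : 'I_r, P j = (j == i)) -> \sum_(j < r) P j * w j = w i.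
  move=> Pi; rewrite (bigD1 i) //= Pi eqxx mul1n big1 ?addn0 // => j ji.
  by rewrite Pi (negPf ji).
(* The left side is p ^ (s + alpha i) - 1. Its p ^ s - 1 is the first block when i = 0, and
   otherwise the bound inherited from coordinate i - 1. *)
have weight_lt (i : 'I_r) : (p ^ s).-1 + p ^ s * (p ^ alpha i).-1 < p ^ (s + alpha i).
  by rewrite expnD -[X in _ < _ * X](ltn_predK (q_gt1 i)) mulnS ltn_add2r prednK.
(* An element that is 1 at i but not at i - 1 is a copy of [tail_indicator i],
   so by induction the counts stay below p ^ (s + alpha i), hence below p ^ s. *)
have count_lt (i : 'I_r) : count (one_at i) S < p ^ s.
  case: i; elim=> [|i IHi] lti; set j := Ordinal lti; apply: count_small;
    apply: leq_ltn_trans (weight_lt j).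
    have := le_count (one_at j); rewrite !one_at_tail_indicator mul1n.
    under eq_bigr do rewrite one_at_tail_indicator.
    rewrite (sum_pred1 (fun k => k <= 0) j) ?[r <= _]leqNgt ?lti ?addn0 // => k.
    by rewrite leqn0.
  pose k := Ordinal (ltnW lti).
  pose Q : pred (pgroup_ring p alpha) := fun x => one_at j x && ~~ one_at k x.
  have le_Q : count (one_at j) S <= count (one_at k) S + count Q S.
    rewrite -count_predUI (leq_trans _ (leq_addr _ _)) // sub_count // => x.
    by rewrite /Q !inE => ->; rewrite orbN.
  apply: leq_trans le_Q _; apply: leq_add; first by rewrite -ltnS prednK // IHi.
  have QE c : Q (tail_indicator c) = (c == i.+1).
    by rewrite /Q !one_at_tail_indicator /=; lia.
  have := le_count Q; rewrite !QE (gtn_eqF lti) addn0.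
  under eq_bigr do rewrite QE.
  by rewrite (sum_pred1 (fun c => c == i.+1) j).
(* Entries that are not 1 at the last coordinate are zeros, at most t - p ^ s in number; the others
   are fewer than p ^ s, so S has fewer than t entries. *)
have ltr : r.-1 < r by rewrite prednK.
pose i := Ordinal ltr.
pose Q : pred (pgroup_ring p alpha) := fun x => ~~ one_at i x.
have QE c : Q (tail_indicator c) = (r.-1 < c).
  by rewrite /Q one_at_tail_indicator -ltnNge.
have := le_count Q; rewrite !QE big1 => [|j _]; last first.
  by rewrite QE ltnNge -ltnS prednK // ltn_ord.
have : count (one_at i) S + count Q S = t by rewrite -szS -(count_predC (one_at i)).
have := count_lt i; rewrite prednK // leqnn [r <= 0]leqNgt r_gt0 mul0n mul1n.
by move: (count _ S) (count _ S) => a b; lia.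
Qed.

Lemma EGZ_bound_pgroup_ge z : EGZ_bound t (pgroup_ring p alpha) (p ^ s) z ->
  t + p ^ s * \sum_(j < r) (p ^ alpha j - 1) <= z.
Proof.
case=> z_gt0 zP; rewrite leqNgt; apply/negP => lt_z.
have [|S [sS szS]] := zP extremal_mset; first by rewrite size_extremal_mset; lia.
exact: extremal_mset_zero_free.
Qed.

End EGZLower.

Theorem theorem2p21 (p r : nat) (alpha : 'I_r -> nat) (h : nat)
    (p_prime : prime p) (r_gt0 : (0 < r)%N)
    (alpha_gt0 : forall j : 'I_r, (0 < alpha j)%N)
    (hE : h = (\sum_(j < r) alpha j)%N) :
  [/\ forall m : nat, (1 <= m)%N ->
        (\sum_(j < r) m * (p ^ alpha j - 1) < p ^ h)%N ->
        (EGZ (p ^ h) (pgroup_ring p alpha) m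
           <= (Posz (p ^ h + m * \sum_(j < r) (p ^ alpha j - 1))%N)%:E)%E,
      forall s t : nat, (p ^ s <= t)%N ->
        ((Posz (t + p ^ s * \sum_(j < r) (p ^ alpha j - 1))%N)%:E
           <= EGZ t (pgroup_ring p alpha) (p ^ s))%E
    & forall s : nat,
        (\sum_(j < r) p ^ s * (p ^ alpha j - 1) < p ^ h)%N ->
        EGZ (p ^ h) (pgroup_ring p alpha) (p ^ s)
          = (Posz (p ^ h + p ^ s * \sum_(j < r) (p ^ alpha j - 1))%N)%:E].

Proof.
have EGZ_upper m : (1 <= m)%N ->
    (\sum_(j < r) m * (p ^ alpha j - 1) < p ^ h)%N ->
    (EGZ (p ^ h) (pgroup_ring p alpha) m
       <= (Posz (p ^ h + m * \sum_(j < r) (p ^ alpha j - 1))%N)%:E)%E.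
  by move=> m_gt0 lt_h; apply/EGZ_le/EGZ_pgroup_bound.
have EGZ_lower s t : (p ^ s <= t)%N ->
    ((Posz (t + p ^ s * \sum_(j < r) (p ^ alpha j - 1))%N)%:E
       <= EGZ t (pgroup_ring p alpha) (p ^ s))%E.
  by move=> le_st; apply: EGZ_ge => z; apply: EGZ_bound_pgroup_ge.
split=> // s lt_h; have ps_gt0 : 0 < p ^ s by rewrite expn_gt0 prime_gt0.
apply/eqP; rewrite eq_le EGZ_upper //= EGZ_lower //.
(* The lower bound at t = p ^ h needs p ^ s <= p ^ h: a single summand of the hypothesis is already
   at least p ^ s. *)
apply: leq_trans (ltnW lt_h); rewrite (bigD1 (Ordinal r_gt0)) //=.
apply: leq_trans (leq_addr _ _); rewrite leq_pmulr // subn_gt0.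
by rewrite -(expn0 p) ltn_exp2l ?prime_gt1.
Qed.
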